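(* Let $p:\widehat{X}\to X$ be a map between (non-empty) path-connected spaces. The following are equivalent: (1) $p$ has continuous lifting of paths; (2) $p$ is a weak $\mathcal{F}$-covering map; (3) $p$ is a weak $\mathbf{Cntr}$-covering map.
   Context: Maps are continuous functions. For a space $X$ and $x\in X$, $P(X,x)$ is the space of paths $\alpha:[0,1]\to X$ with $\alpha(0)=x$, with the compact-open topology. A map $f:X\to Y$ has continuous lifting of paths if for every $x\in X$ the induced map $f_{\#}:P(X,x)\to P(Y,f(x))$, $f_{\#}(\alpha)=f\circ\alpha$, is a homeomorphism. For a full subcategory $\mathcal{C}$ of the category of non-empty path-connected spaces with the closed unit disk $D^2\in\mathcal{C}$, a map $p:\widehat{X}\to X$ is a weak $\mathcal{C}$-covering map if for every $Y\in\mathcal{C}$, $\hat{x}\in\widehat{X}$, $y\in Y$ and based map $f:(Y,y)\to(X,p(\hat{x}))$ with $f_*(\pi_1(Y,y))\subseteq p_*(\pi_1(\widehat{X},\hat{x}))$, there is a unique map $\hat{f}:(Y,y)\to(\widehat{X},\hat{x})$ with $p\circ\hat{f}=f$. Let $(J,\leq)$ be a directed set and $K=J\cup\{\infty\}$ be obtained by adding one maximal point $\infty$. Give $K$ the topology generated by the basis sets $\{k\}$ and $V_k=\{\infty\}\cup\{j\in J : j>k\}$ for $k\in J$. The directed arc-fan over $J$ is the cone $F(J)=(K\times[0,1])/(K\times\{0\})$ with the quotient topology. $\mathcal{F}$ is the category whose objects are $D^2$ and the directed arc-fans $F(J)$ for all directed sets $J$. $\mathbf{Cntr}$ is the category of contractible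 spaces. *)

(* Defs.v *)
From HB Require Import structures.
From mathcomp Require Import all_boot all_order all_algebra generic_quotient.
From mathcomp Require Import all_classical all_reals topology normedtype.
From mathcomp Require Import continuous_path.
Import Order.TTheory GRing.Theory Num.Theory numFieldNormedType.Exports.

Set Implicit Arguments.
Unset Strict Implicit.
Unset Printing Implicit Defensive.

Local Open Scope classical_set_scope.
Local Open Scope ring_scope.
Local Open Scope quotient_scope.

Section UnitInterval.
Variable R : realType.

Definition unit_interval : Type := set_type (`[0, 1]%classic : set R).

HB.instance Definition _ := Topological.on unit_interval.

Let mem0 : (0 : R) \in (`[0, 1]%classic : set R).
Proof. by rewrite inE /= in_itv /= lexx ler01. Qed.

Let mem1 : (1 : R) \in (`[0, 1]%classic : set R).
Proof. by rewrite inE /= in_itv /= lexx ler01. Qed.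

Let zero_neq_one : (exist _ 0 mem0 : unit_interval) != exist _ 1 mem1.
Proof. by rewrite -val_eqE /= eq_sym oner_eq0. Qed.

(* [zero] and [one] are the endpoints, as for any bipointed space. *)
HB.instance Definition _ :=
  isBiPointed.Build unit_interval zero_neq_one.

End UnitInterval.

Definition homeomorphism (S T : topologicalType) (f : S -> T) : Prop :=
  exists g : T -> S, [/\ cancel f g, cancel g f, continuous f & continuous g].

Section PathSpaces.
Variable R : realType.
Local Notation I := (unit_interval R).

Definition path_connected (X : topologicalType) : Prop :=
  [set: X] !=set0 /\
  forall x y : X, inhabited {path I from x to y in X}.

(* As a type, [path_space x] is a [set_type], hence carries the subspace
   topology inherited from the compact-open topology. *)
Definition path_space (X : topologicalType) (x : X) :
    set {compact-open, I -> X} :=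
  [set a | continuous (a : I -> X) /\ (a : I -> X) zero = x].

Lemma path_space_comp (X Y : topologicalType) (f : continuousType X Y) (x : X)
    (a : path_space x) :
  (f \o (\val a : I -> X) : {compact-open, I -> Y}) \in path_space (f x).
Proof.
case: a => a /= /set_mem[ca a0]; apply/mem_set; split => /=.
  by move=> t; apply: continuous_comp; [exact: ca | exact: cts_fun].
by rewrite a0.
Qed.

Definition path_space_map (X Y : topologicalType) (f : continuousType X Y)
    (x : X) (a : path_space x) : path_space (f x) :=
  exist _ (f \o (\val a : I -> X)) (path_space_comp f a).

Definition continuous_lifting_of_paths (X Y : topologicalType)
    (f : continuousType X Y) : Prop :=
  forall x : X, homeomorphism (@path_space_map X Y f x).

End PathSpaces.

Arguments path_space R {X} x.

Section FundamentalGroup.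
Variable R : realType.
Local Notation I := (unit_interval R).

(* Homotopy relative to the endpoints; it forces [a] and [b] to be continuous
   with the same endpoints. *)
Definition path_homotopic (X : topologicalType) (a b : I -> X) : Prop :=
  exists H : I * I -> X,
    [/\ continuous H,
        forall s, H (s, zero) = a s,
        forall s, H (s, one) = b s,
        forall t, H (zero, t) = a zero
      & forall t, H (one, t) = a one].

Definition path_class (X : topologicalType) (a : I -> X) : set (I -> X) :=
  [set b | path_homotopic a b].

(* The underlying set of the fundamental group: its elements are the classes
   of loops at [x], each being a set of functions. The class of a function
   does not mention [x], so that for f y = p xh the images of [pi1 y] under f
   and of [pi1 xh] under p live in the same type, without transport. *)
Definition pi1 (X : topologicalType) (x : X) : set (set (I -> X)) :=
  range (fun a : {path I from x to x in X} => path_class a).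

(* Sends the class of [a] to the class of [f \o a]. *)
Definition pi1_map (X Y : topologicalType) (f : X -> Y) (c : set (I -> X)) :
    set (I -> Y) :=
  \bigcup_(a in c) path_class (f \o a).

Definition weak_covering_map (C : topologicalType -> Prop)
    (Xh X : topologicalType) (p : continuousType Xh X) : Prop :=
  forall Y : topologicalType, C Y ->
  forall (xh : Xh) (y : Y) (f : continuousType Y X),
    f y = p xh ->
    pi1_map f @` pi1 y `<=` pi1_map p @` pi1 xh ->
    exists! fh : Y -> Xh,
      [/\ continuous fh, fh y = xh & p \o fh = (f : Y -> X)].

Definition contractible (Y : topologicalType) : Prop :=
  exists (y0 : Y) (H : Y * I -> Y),
    [/\ continuous H, forall y, H (y, zero) = y & forall y, H (y, one) = y0].

End FundamentalGroup.

Arguments pi1 R {X} x.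

Section Cone.
Variables (R : realType) (T : topologicalType).
Local Notation I := (unit_interval R).

Let cone_rel' (a b : T * I) := (a == b) || ((a.2 == zero) && (b.2 == zero)).

Let cone_refl : reflexive cone_rel'.
Proof. by move=> a; rewrite /cone_rel' eqxx. Qed.

Let cone_sym : symmetric cone_rel'.
Proof. by move=> a b; rewrite /cone_rel' eq_sym andbC. Qed.

Let cone_trans : transitive cone_rel'.
Proof.
move=> b a c /orP[/eqP -> //|/andP[a0 b0]] /orP[/eqP <-|/andP[_ c0]].
  by rewrite /cone_rel' a0 b0 orbT.
by rewrite /cone_rel' a0 c0 orbT.
Qed.

Definition cone_rel := EquivRel cone_rel' cone_refl cone_sym cone_trans.

Definition cone := {eq_quot cone_rel}.

HB.instance Definition _ := Topological.copy cone (quotient_topology cone).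
HB.instance Definition _ := Quotient.on cone.

End Cone.

Definition directed_set d (J : preorderType d) : Prop :=
  [set: J] !=set0 /\ forall i j : J, exists k : J, (i <= k)%O /\ (j <= k)%O.

(* [Some j] is the point j of J and [None] is the added point at infinity. *)
Definition with_infty d (J : preorderType d) : Type := option J.

Section WithInfty.
Variables (d : Order.disp_t) (J : preorderType d).
Local Notation K := (with_infty J).

HB.instance Definition _ := Choice.on K.

Definition infty_tail (k : J) : set K :=
  [set x | if x is Some j then (k < j)%O else true].

Definition with_infty_base : set (set K) :=
  range (fun k : J => [set (Some k : K)]) `|` range infty_tail.

(* The topology generated by [with_infty_base]; for J directed this family is
   a base, as the next two lemmas show. *)
HB.instance Definition _ := @isSubBaseTopological.Build K
  (set K) with_infty_base id.

Lemma with_infty_base_cover :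
  directed_set J -> \bigcup_(A in with_infty_base) A = setT.
Proof.
case=> -[k _] _; rewrite -subTset => -[j|] _.
  by exists [set (Some j : K)] => //; left; exists j.
by exists (infty_tail k) => //; right; exists k.
Qed.

Lemma with_infty_base_join (A B : set K) (x : K) : directed_set J ->
  with_infty_base A -> with_infty_base B -> A x -> B x ->
  exists2 C, with_infty_base C & C x /\ C `<=` A `&` B.
Proof.
case=> _ dirJ bA bB Ax Bx; case: x Ax Bx => [j|] Ax Bx.
  exists [set (Some j : K)]; first by left; exists j.
  by split=> // _ ->.
case: bA Ax => -[k _ <-] //= _; case: bB Bx => -[l _ <-] //= _.
have [m [km lm]] := dirJ k l.
exists (infty_tail m); first by right; exists m.
split=> // -[j|] //= mj; split=> /=.
  exact: Order.PreorderTheory.le_lt_trans km mj.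
exact: Order.PreorderTheory.le_lt_trans lm mj.
Qed.

End WithInfty.

Definition arc_fan (R : realType) d (J : preorderType d) : topologicalType :=
  cone R (with_infty J).

Definition unit_disk (R : realType) : topologicalType :=
  set_type [set z : R * R | z.1 ^+ 2 + z.2 ^+ 2 <= 1].

(* Full subcategories are given by their classes of objects. *)
Inductive fan_category (R : realType) : topologicalType -> Prop :=
| Fan_disk : fan_category R (unit_disk R)
| Fan_arc_fan d (J : preorderType d) :
    directed_set J -> fan_category R (arc_fan R J).

(* Main.v *)
Require Import Defs.
From HB Require Import structures.
From mathcomp Require Import all_boot all_order all_algebra generic_quotient.
From mathcomp Require Import finmap.
From mathcomp Require Import all_classical all_reals topology normedtype.
From mathcomp Require Import continuous_path.
Import Order.TTheory GRing.Theory Num.Theory numFieldNormedType.Exports.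

Set Implicit Arguments.
Unset Strict Implicit.
Unset Printing Implicit Defensive.

Local Open Scope classical_set_scope.
Local Open Scope ring_scope.
Local Open Scope quotient_scope.

(* (1) => (3): in a contractible space every point is joined to the center of the
   contraction by a path depending continuously on the point, so a map is lifted
   by lifting these paths and taking endpoints.
   (3) => (2): the disk and the arc-fans are contractible.
   (2) => (1): the contraction of a fan fixes the apex, so loops at the apex are
   null-homotopic and the condition on fundamental groups is automatic there. A
   map from K * I to X that is constant on K * {0} is a map from the fan, hence
   lifts uniquely. A single path gives bijectivity of the induced map on path
   spaces, and a net of paths indexed by K gives continuity of its inverse, since
   continuity can be tested on convergent nets. *)

(** * Continuity of composites and pairs *)

Lemma comp_continuous (T U V : topologicalType) (f : T -> U) (g : U -> V) :
  continuous f -> continuous g -> continuous (fun x => g (f x)).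
Proof. by move=> cf cg x; exact: continuous_comp (cf x) (cg (f x)). Qed.

Lemma pair_continuous (T U V : topologicalType) (f : T -> U) (g : T -> V) :
  continuous f -> continuous g -> continuous (fun x => (f x, g x)).
Proof. by move=> cf cg x; exact: cvg_pair (cf x) (cg x). Qed.

Lemma fst_continuous (T U : topologicalType) : continuous (@fst T U).
Proof. by move=> x; exact: cvg_fst. Qed.

Lemma snd_continuous (T U : topologicalType) : continuous (@snd T U).
Proof. by move=> x; exact: cvg_snd. Qed.

Lemma id_continuous (T : topologicalType) : continuous (fun x : T => x).
Proof. by move=> x; exact: cvg_id. Qed.

(** * The unit interval as a retract of the line *)

Section UnitIntervalTheory.
Variable R : realType.
Local Notation I := (unit_interval R).

Lemma val_zero : set_val (zero : I) = 0 :> R.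
Proof. by []. Qed.

Lemma val_one : set_val (one : I) = 1 :> R.
Proof. by []. Qed.

Lemma unit_interval_bounds (t : I) : 0 <= (set_val t : R) <= 1.
Proof. by have := set_mem (valP t); rewrite /= in_itv. Qed.

Lemma clamp_subproof (x : R) :
  Num.max 0 (Num.min 1 x) \in (`[0, 1]%classic : set R).
Proof.
by apply/mem_set; rewrite /= in_itv /= le_max lexx ge_max ler01 ge_min lexx.
Qed.

(** A retraction of the line: reparametrizations are written by arithmetic in [R] and sent back to
    [I], and bounds are checked only to compute values. *)
Definition clamp (x : R) : I :=
  exist _ (Num.max 0 (Num.min 1 x)) (clamp_subproof x).

Lemma clampE (x : R) : 0 <= x <= 1 -> set_val (clamp x) = x.
Proof.
move=> /andP[x0 x1].
by rewrite /clamp set_valE /= (min_idPr x1) (max_idPr x0).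
Qed.

Lemma clampK (t : I) : clamp (set_val t) = t.
Proof. by apply/val_inj; apply: clampE; exact: unit_interval_bounds. Qed.

Lemma set_val_continuous : continuous (set_val : I -> R).
Proof. exact: initial_continuous. Qed.

Lemma clamp_continuous : continuous clamp.
Proof.
apply: (@continuous_comp_initial _ _ R set_val clamp).
move=> x; apply: (@continuous_max R R (cst 0) (fun x => Num.min 1 x)).
  exact: cvg_cst.
apply: (@continuous_min R R (cst 1) id); first exact: cvg_cst.
exact: cvg_id.
Qed.

Lemma clamp_le0 (x : R) : x <= 0 -> clamp x = zero.
Proof.
move=> x0; apply/val_inj => /=.
by rewrite (min_idPr (le_trans x0 ler01)); apply/max_idPl.
Qed.

Lemma clamp_ge1 (x : R) : 1 <= x -> clamp x = one.
Proof.
move=> x1; apply/val_inj => /=.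
by rewrite (min_idPl x1); apply/max_idPr; exact: ler01.
Qed.

Lemma unit_interval_compact : compact [set: I].
Proof.
have -> : [set: I] = clamp @` `[0, 1]%classic.
  apply/seteqP; split=> // t _; exists (set_val t); last exact: clampK.
  exact: unit_interval_bounds.
apply: continuous_compact; last exact: segment_compact.
exact/continuous_subspaceT/clamp_continuous.
Qed.

(** Together with regularity, this allows continuous maps into the compact-open function space to be
    uncurried. *)
Lemma unit_interval_locally_compact : locally_compact [set: I].
Proof.
move=> t _; rewrite withinET; exists setT; first exact: filterT.
by split; [exact: unit_interval_compact|exact: closedT].
Qed.

Lemma unit_interval_regular : regular_space I.
Proof.
exact: (@uniform_regular (set_type (`[0, 1]%classic : set R))).
Qed.

Definition rev_param (t : I) : I := clamp (1 - set_val t).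

Lemma rev_param_continuous : continuous rev_param.
Proof.
apply: comp_continuous clamp_continuous => t.
apply: (@continuousB R R I); first exact: cst_continuous.
exact: set_val_continuous.
Qed.

Lemma rev_paramK : involutive rev_param.
Proof.
move=> t; have /andP[t0 t1] := unit_interval_bounds t.
rewrite /rev_param clampE; first by rewrite subKr clampK.
by rewrite subr_ge0 t1 lerBlDr lerDl.
Qed.

Lemma rev_param0 : rev_param zero = one.
Proof. by apply: clamp_ge1; rewrite val_zero subr0. Qed.

Lemma rev_param1 : rev_param one = zero.
Proof. by rewrite -rev_param0 rev_paramK. Qed.

End UnitIntervalTheory.

(** * Path spaces and the exponential law *)

Section PathSpaceTheory.
Variable R : realType.
Local Notation I := (unit_interval R).

Lemma path_space_continuous (X : topologicalType) (x : X)
  (a : path_space R x) : continuous (\val a : I -> X).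
Proof. by have [] := set_mem (valP a). Qed.

Lemma path_space_zero (X : topologicalType) (x : X)
  (a : path_space R x) : (\val a : I -> X) zero = x.
Proof. by have [] := set_mem (valP a). Qed.

Definition mk_path_space (X : topologicalType) (x : X) (a : I -> X)
    (ca : continuous a) (a0 : a zero = x) : path_space R x :=
  exist _ (a : {compact-open, I -> X}) (mem_set (conj ca a0)).

(** Evaluation of paths is jointly continuous because [I] is locally compact and regular, so a
    continuous family of paths is a homotopy. *)
Lemma path_space_uncurry (Y X : topologicalType) (x : X)
    (a : Y -> path_space R x) : continuous a ->
  continuous (fun z : Y * I => (\val (a z.1) : I -> X) z.2).
Proof.
move=> ca.
have -> : (fun z : Y * I => (\val (a z.1) : I -> X) z.2) =
    uncurry (fun y => \val (a y) : I -> X) by apply/funext => -[].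
apply: continuous_uncurry_regular.
- exact: unit_interval_locally_compact.
- exact: unit_interval_regular.
- move=> y; apply: (@continuous_comp _ _ _ a
    (set_val : path_space R x -> {compact-open, I -> X})); first exact: ca.
  exact: initial_continuous.
- by move=> y; exact: path_space_continuous.
Qed.

Lemma path_space_curry (Y X : topologicalType) (x : X) (h : Y * I -> X) :
  continuous h -> (forall y, h (y, zero) = x) ->
  exists2 a : Y -> path_space R x, continuous a &
    forall y t, (\val (a y) : I -> X) t = h (y, t).
Proof.
move=> ch h0; have [ch1 ch2] := continuous_curry ch.
exists (fun y => mk_path_space (ch2 y) (h0 y)) => //.
exact: (@continuous_comp_initial _ _ {compact-open, I -> X} set_val).
Qed.

(** Uncurrying the identity gives the evaluation map; composing it with [f] and currying back yields
    the induced map. *)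
Lemma path_space_map_continuous (X Y : topologicalType)
  (f : continuousType X Y) (x : X) : continuous (@path_space_map R X Y f x).
Proof.
have [||a ca aE] :=
  @path_space_curry _ _ (f x)
    (fun z : path_space R x * I => f ((\val z.1 : I -> X) z.2)).
- have ev := @path_space_uncurry _ _ x id (@id_continuous _).
  exact: comp_continuous ev (@cts_fun _ _ f).
- by move=> y; rewrite /= path_space_zero.
- suff -> : path_space_map f (x := x) = a by [].
  by apply/funext => b; apply/val_inj/funext => t; rewrite aE.
Qed.

End PathSpaceTheory.

(** * Lifting over contractible spaces *)

Section ContinuousLifting.
Variables (R : realType) (Xh X : topologicalType) (p : continuousType Xh X).
Hypothesis clp : continuous_lifting_of_paths R p.
Local Notation I := (unit_interval R).

(** This is injectivity of the induced map on paths from [b zero]. *)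
Lemma unique_path_lift (a b : I -> Xh) : continuous a -> continuous b ->
  a zero = b zero -> p \o a = p \o b -> a = b.
Proof.
move=> ca cb ab0 pab; have [g [gK _ _ _]] := clp (b zero).
pose a' := mk_path_space ca ab0; pose b' := mk_path_space cb erefl.
suff /(congr1 val) : a' = b' by [].
by apply: (can_inj gK); apply/val_inj.
Qed.

(** Curried, the homotopy is a continuous family of paths from [p xh], to which the inverse of the
    induced map applies. Continuity of that inverse makes the lifted family a homotopy. *)
Lemma homotopy_lift (Y : topologicalType) (h : Y * I -> X) (xh : Xh) :
  continuous h -> (forall y, h (y, zero) = p xh) ->
  exists hh : Y * I -> Xh, [/\ continuous hh,
    forall y, hh (y, zero) = xh & forall z, p (hh z) = h z].
Proof.
move=> ch h0; have [g [_ gK _ cg]] := clp xh.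
have [a ca aE] := path_space_curry ch h0.
exists (fun z => (\val (g (a z.1)) : I -> Xh) z.2); split.
- apply: (@path_space_uncurry _ _ _ _ (g \o a)) => y.
  by apply: continuous_comp; [exact: ca|exact: cg].
- by move=> y; rewrite path_space_zero.
- case=> y t /=; rewrite -aE -[in RHS](gK (a y)).
  by [].
Qed.

Lemma path_lift (a : I -> X) (xh : Xh) : continuous a -> a zero = p xh ->
  exists ah : I -> Xh, [/\ continuous ah, ah zero = xh & p \o ah = a].
Proof.
move=> ca a0; have [g [_ gK _ _]] := clp xh.
exists (\val (g (mk_path_space ca a0))); split.
- exact: path_space_continuous.
- exact: path_space_zero.
- by have /(congr1 val) := gK (mk_path_space ca a0).
Qed.

(* The path from the base point to the center [y0] is lifted first, to find the
   value of the lift at [y0]; the reversed paths [H (z, _)] propagate it. *)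
Lemma clp_weak_covering : weak_covering_map R (contractible R) p.
Proof.
move=> Y [y0 [H [cH H0 H1]]] xh y f fy _.
have cHr z : continuous (fun t => H (z, t)).
  apply: comp_continuous cH.
  by apply: pair_continuous; [exact: cst_continuous|exact: id_continuous].
have cHrev z : continuous (fun t => H (z, rev_param t)).
  exact: comp_continuous (@rev_param_continuous R) (cHr z).
have [||g [cg g0 pg]] := @path_lift (fun t => f (H (y, t))) xh.
- exact: comp_continuous (cHr y) (@cts_fun _ _ f).
- by rewrite H0.
(* Reversal makes every path start at [f y0], which lies under [g one], and end at [f z]. *)
have [||h [ch h0 ph]] :=
    @homotopy_lift Y (fun z => f (H (z.1, rev_param z.2))) (g one).
- apply: comp_continuous (@cts_fun _ _ f); apply: comp_continuous cH.
  apply: pair_continuous; first exact: fst_continuous.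
  exact: comp_continuous (@snd_continuous _ _) (@rev_param_continuous R).
- move=> z; rewrite /= rev_param0 H1 -(H1 y).
  exact: (esym (congr1 (@^~ one) pg)).
exists (fun z => h (z, one)); split; [split|].
- apply: comp_continuous ch.
  by apply: pair_continuous; [exact: id_continuous|exact: cst_continuous].
(* Both sides lift the same path from [g one], so [h (y, one)] is [g zero], that is [xh]. *)
- have hyg : (fun t => h (y, t)) = (fun t => g (rev_param t)).
    apply: unique_path_lift.
    + apply: comp_continuous ch.
      by apply: pair_continuous; [exact: cst_continuous|exact: id_continuous].
    + exact: comp_continuous (@rev_param_continuous R) cg.
    + by rewrite h0 rev_param0.
    + by apply/funext => t /=; rewrite ph /= -[RHS]/((p \o g) _) pg.
  by rewrite -[LHS]/((fun t => h (y, t)) one) hyg rev_param1.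
- by apply/funext => z; rewrite /= ph rev_param1 H0.
(* Uniqueness: [k] carries the contraction path of [y] to [g], so its value at the center is
   [g one]. Along the path from the center to [z] it must then follow [h]. *)
- move=> k [ck ky pk]; apply/funext => z.
  have pkE z' : p (k z') = f z' by rewrite -pk.
  have kg : (fun t => k (H (y, t))) = g.
    apply: unique_path_lift; first exact: comp_continuous (cHr y) ck.
    + exact: cg.
    + by rewrite H0 ky g0.
    + by rewrite pg; apply/funext => t /=.
  suff : (fun t => h (z, t)) = (fun t => k (H (z, rev_param t))).
    by move/(congr1 (@^~ one)); rewrite rev_param1 H0.
  apply: unique_path_lift.
  + apply: comp_continuous ch.
    by apply: pair_continuous; [exact: cst_continuous|exact: id_continuous].
  + exact: comp_continuous (cHrev z) ck.
  + by rewrite h0 rev_param0 H1 -kg H1.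
  + by apply/funext => t /=; rewrite ph pkE.
Qed.

End ContinuousLifting.

(** * Contractions of the disk and of cones *)

Section Contractibility.
Variable R : realType.
Local Notation I := (unit_interval R).

Lemma unit_disk_scale_subproof (z : unit_disk R) (t : I) :
  (set_val t * (set_val z).1, set_val t * (set_val z).2) \in
    [set w : R * R | w.1 ^+ 2 + w.2 ^+ 2 <= 1].
Proof.
have /set_mem /= z1 := valP z.
have /andP[t0 t1] := unit_interval_bounds t.
apply/mem_set; rewrite /= !exprMn -mulrDr.
apply: le_trans z1; apply: ler_piMl; first by rewrite addr_ge0 ?sqr_ge0.
by rewrite expr_le1.
Qed.

Definition unit_disk_scale (z : unit_disk R) (t : I) : unit_disk R :=
  exist _ (set_val t * (set_val z).1, set_val t * (set_val z).2)
    (unit_disk_scale_subproof z t).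

Lemma unit_disk_contractible : contractible R (unit_disk R).
Proof.
have in0 : ((0, 0) : R * R) \in [set w : R * R | w.1 ^+ 2 + w.2 ^+ 2 <= 1].
  by apply/mem_set; rewrite /= expr0n addr0 ler01.
pose o : unit_disk R := exist _ (0, 0) in0.
exists o, (fun w => unit_disk_scale w.1 (rev_param w.2)); split.
- apply: (@continuous_comp_initial _ _ (R * R)%type set_val).
  have cr : continuous
      (fun w : unit_disk R * I => set_val (rev_param w.2) : R).
    apply: comp_continuous (@set_val_continuous R).
    exact: comp_continuous (@snd_continuous _ _) (@rev_param_continuous R).
  have cz : continuous (fun w : unit_disk R * I => set_val w.1 : R * R).
    apply: comp_continuous (@fst_continuous _ _) _.
    exact: initial_continuous.
  have c1 := comp_continuous cz (@fst_continuous R R).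
  have c2 := comp_continuous cz (@snd_continuous R R).
  have c1' := fun w => continuousM (cr w) (c1 w).
  have c2' := fun w => continuousM (cr w) (c2 w).
  exact: pair_continuous c1' c2'.
- move=> z; apply/val_inj => /=.
  by rewrite rev_param0 val_one !mul1r -surjective_pairing.
- by move=> z; apply/val_inj => /=; rewrite rev_param1 val_zero !mul0r.
Qed.

Definition mul_param (s t : I) : I := clamp (set_val s * set_val t).

Lemma mul_param_continuous : continuous (fun st : I * I => mul_param st.1 st.2).
Proof.
have c1 := comp_continuous (@fst_continuous I I) (@set_val_continuous R).
have c2 := comp_continuous (@snd_continuous I I) (@set_val_continuous R).
have c12 := fun st => continuousM (c1 st) (c2 st).
exact: comp_continuous c12 (@clamp_continuous R).
Qed.

Lemma mul_param1 (s : I) : mul_param s one = s.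
Proof. by rewrite /mul_param val_one mulr1 clampK. Qed.

Lemma mul_param0 (s : I) : mul_param s zero = zero.
Proof. by rewrite /mul_param val_zero mulr0 clamp_le0. Qed.

Lemma mul0_param (s : I) : mul_param zero s = zero.
Proof. by rewrite /mul_param val_zero mul0r clamp_le0. Qed.

Variable T : topologicalType.

Definition cone_pi (k : T) (s : I) : cone R T := \pi_(cone R T) (k, s).

Lemma cone_pi_continuous :
  continuous (fun ks : T * I => cone_pi ks.1 ks.2).
Proof.
have -> : (fun ks : T * I => cone_pi ks.1 ks.2) = \pi_(cone R T).
  by apply/funext => -[].
exact: pi_continuous.
Qed.

Lemma cone_piP (c : cone R T) : exists k s, c = cone_pi k s.
Proof.
exists (repr c).1, (repr c).2.
by rewrite /cone_pi -surjective_pairing reprK.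
Qed.

Lemma cone_pi0 (k l : T) : cone_pi k zero = cone_pi l zero.
Proof. by apply/eqmodP; rewrite /= !eqxx orbT. Qed.

(** A chosen representative makes this total; it is the factorization of [g] through the cone once
    [g] takes a single value at [zero]. *)
Definition cone_lift (Z : Type) (g : T -> I -> Z) (c : cone R T) : Z :=
  g (repr c).1 (repr c).2.

Lemma cone_lift_pi (Z : Type) (g : T -> I -> Z) (k : T) (s : I) :
  (forall k l, g k zero = g l zero) -> cone_lift g (cone_pi k s) = g k s.
Proof.
move=> g0; have /eqmodP := reprK (cone_pi k s).
rewrite /cone_lift /=; case: (repr _) => l t /orP[/eqP[-> ->]//|/= /andP[]].
by move=> /eqP -> /eqP ->.
Qed.

Lemma cone_lift_continuous (Z : topologicalType) (g : T -> I -> Z) :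
  (forall k l, g k zero = g l zero) ->
  continuous (fun ks : T * I => g ks.1 ks.2) -> continuous (cone_lift g).
Proof.
move=> g0 cg; apply/(@quotient_continuous _ _ Z) => /=.
suff -> : cone_lift g \o \pi_(cone R T) = (fun ks => g ks.1 ks.2) by [].
by apply/funext => -[k s] /=; exact: cone_lift_pi.
Qed.

(* The product of the quotient map with the identity of [I] need not be handled
   directly: since [I] is locally compact, the homotopy is obtained by
   uncurrying a map from the cone to a function space. *)
Lemma cone_contraction : exists H : cone R T * I -> cone R T,
  continuous H /\ forall k s t, H (cone_pi k s, t) = cone_pi k (mul_param s t).
Proof.
(* [G k s] is the segment from the apex to [cone_pi k s]. For [s = zero] it is constant at the apex,
   so [G] descends to the cone. *)
pose G (k : T) (s : I) : {compact-open, I -> cone R T} :=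
  fun t => cone_pi k (mul_param s t).
have G0 k l : G k zero = G l zero.
  by apply/funext => t; rewrite /G mul0_param; exact: cone_pi0.
have cG3 : continuous
    (fun w : (T * I) * I => cone_pi w.1.1 (mul_param w.1.2 w.2)).
  have c1 := @fst_continuous (T * I)%type I.
  have c11 := comp_continuous c1 (@fst_continuous T I).
  have c12 := comp_continuous c1 (@snd_continuous T I).
  have c22 := pair_continuous c12 (@snd_continuous (T * I)%type I).
  have cm := comp_continuous c22 mul_param_continuous.
  exact: comp_continuous (pair_continuous c11 cm) cone_pi_continuous.
have [cG1 cG2] := continuous_curry cG3.
exists (uncurry (cone_lift G)); split; last first.
  by move=> k s t; rewrite /= cone_lift_pi.
apply: continuous_uncurry_regular.
- exact: unit_interval_locally_compact.
- exact: unit_interval_regular.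
- exact: (@cone_lift_continuous {compact-open, I -> cone R T} G G0 cG1).
- by move=> c; exact: (cG2 (repr c)).
Qed.

Lemma cone_contractible (k0 : T) : contractible R (cone R T).
Proof.
have [H [cH HE]] := cone_contraction.
(* [H] is constant at time [zero] and the identity at time [one], hence the reversal. *)
exists (cone_pi k0 zero), (fun z => H (z.1, rev_param z.2)); split.
- apply: comp_continuous cH.
  apply: pair_continuous; first exact: fst_continuous.
  exact: comp_continuous (@snd_continuous _ _) (@rev_param_continuous R).
- move=> c; have [k [s ->]] := cone_piP c.
  by rewrite /= rev_param0 HE mul_param1.
- move=> c; have [k [s ->]] := cone_piP c; rewrite /= rev_param1 HE mul_param0.
  exact: cone_pi0.
Qed.

End Contractibility.

Lemma fan_category_contractible (R : realType) (Y : topologicalType) :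
  fan_category R Y -> contractible R Y.
Proof.
case=> [|d J _]; first exact: unit_disk_contractible.
exact: (cone_contractible _ (None : with_infty J)).
Qed.

(** * Convergent nets as continuous maps from [with_infty J] *)

Section Nets.

Lemma with_infty_isolated d (J : preorderType d) (j : J) :
  nbhs (Some j : with_infty J) [set (Some j : with_infty J)].
Proof.
apply: open_nbhs_nbhs; split=> //.
(* Open sets are unions of finite intersections of subbasic sets; here both the union and the
   intersection have one member. *)
exists [set [set (Some j : with_infty J)]]; last by rewrite bigcup_set1.
move=> _ ->; exists (fset1 [set (Some j : with_infty J)])%fset.
  by move=> A /fset1P ->; apply/mem_set; left; exists j.
by rewrite set_fset1 bigcap_set1.
Qed.

Lemma nbhs_infty_tail d (J : preorderType d) (k : J) :
  nbhs (None : with_infty J) (infty_tail k).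
Proof.
apply: open_nbhs_nbhs; split=> //.
exists [set (infty_tail k)]; last by rewrite bigcup_set1.
move=> _ ->; exists (fset1 (infty_tail k))%fset.
  by move=> A /fset1P ->; apply/mem_set; right; exists k.
by rewrite set_fset1 bigcap_set1.
Qed.

(** Directedness makes the tails a filter base, so it suffices to treat one subbasic set containing
    [None]. Such a set is itself a tail, since the singletons miss [None]. *)
Lemma nbhs_inftyP d (J : preorderType d) (A : set (with_infty J)) :
  directed_set J -> nbhs (None : with_infty J) A ->
  exists k : J, infty_tail k `<=` A.
Proof.
move=> [[j0 _] dirJ].
have FF : Filter (filter_from [set: J] (@infty_tail d J)).
  apply: filter_from_filter; first by exists j0.
  move=> i j _ _; have [k [ik jk]] := dirJ i j; exists k => // -[l|] //= kl.
  by split; [exact: Order.PreorderTheory.le_lt_trans ik kl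
            |exact: Order.PreorderTheory.le_lt_trans jk kl].
rewrite nbhsE => -[O [[D' D'sub <-] [B D'B BN]] OA].
suff [k _ kB] : filter_from [set: J] (@infty_tail d J) B.
  by exists k => x /kB Bx; apply: OA; exists B.
have [E Esub BE] := D'sub _ D'B.
rewrite -BE; apply: filter_bigI => C CE.
move: BN; rewrite -BE => /(_ C CE) /=.
by case: (set_mem (Esub C CE)) => -[k _ <-] // _; exists k.
Qed.

Section NbhsIndex.
Variables (T : topologicalType) (x : T).

(* The natural number makes every index have a strictly larger one, even when
   [x] has a smallest neighbourhood. *)
Definition nbhs_index : Type := (set_type (nbhs x) * nat)%type.

HB.instance Definition _ := Choice.on nbhs_index.

Definition nbhs_index_lt (i j : nbhs_index) : bool :=
  `[< set_val j.1 `<=` set_val i.1 >] && (i.2 < j.2)%N.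

Lemma nbhs_index_lt_irr : irreflexive nbhs_index_lt.
Proof. by move=> i; rewrite /nbhs_index_lt ltnn andbF. Qed.

Lemma nbhs_index_lt_trans : transitive nbhs_index_lt.
Proof.
move=> j i k /andP[/asboolP ij ij'] /andP[/asboolP jk jk'].
apply/andP; split; last exact: ltn_trans ij' jk'.
by apply/asboolP; exact: subset_trans jk ij.
Qed.

HB.instance Definition _ := @Order.Lt_isPreorder.Build Order.default_display
  nbhs_index nbhs_index_lt nbhs_index_lt_irr nbhs_index_lt_trans.

Lemma nbhs_indexP (U : set T) (n : nat) : nbhs x U ->
  exists i : nbhs_index, set_val i.1 = U /\ i.2 = n.
Proof. by move=> xU; exists (exist _ U (mem_set xU), n). Qed.

Lemma nbhs_index_directed : directed_set nbhs_index.
Proof.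
split.
  by have [i _] := nbhs_indexP 0 filterT; exists i.
move=> i j.
have xij : nbhs x (set_val i.1 `&` set_val j.1).
  by apply: filterI; exact: set_valP.
(* The successor puts [k] strictly above both indices, as the order is built from its strict
   part. *)
have [k [k1 k2]] := nbhs_indexP (maxn i.2 j.2).+1 xij.
exists k; split; apply: Order.PreorderTheory.ltW; apply/andP; split;
  rewrite ?k1 ?k2 ?ltnS ?leq_maxl ?leq_maxr //; apply/asboolP.
  exact: subIsetl.
exact: subIsetr.
Qed.

End NbhsIndex.

(** If continuity fails at [x], every neighbourhood of [x] contains a point whose image avoids a
    fixed neighbourhood [W] of [g x]. These points form a net converging to [x] whose image does not
    converge to [g x]. *)
Lemma net_continuous (T U : topologicalType) (g : T -> U) :
  (forall d (J : preorderType d), directed_set J ->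
     forall a : with_infty J -> T, continuous a -> continuous (g \o a)) ->
  continuous g.
Proof.
move=> netg x W gxW; apply: contrapT => ngW.
have /choice[s sP] (i : nbhs_index x) : exists z, set_val i.1 z /\ ~ W (g z).
  apply: contrapT => /forallNP iW; apply: ngW.
  have := set_valP i.1; apply: filterS => z iz /=.
  by apply: contrapT => nWz; apply: (iW z).
have dirJ := nbhs_index_directed x.
(* The net with its limit added. At infinity, continuity holds because all indices beyond one
   carrying [A] choose points of [A]. *)
pose a (k : with_infty (nbhs_index x)) : T := if k is Some i then s i else x.
have ca : continuous a.
  case=> [i|] A /=.
    move=> /nbhs_singleton Asi.
    by apply: filterS (with_infty_isolated i) => _ ->.
  move=> xA; have [i [iA _]] := nbhs_indexP 0 xA.
  apply: filterS (nbhs_infty_tail i) => -[j|_]; last exact: nbhs_singleton.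
  move=> /andP[/asboolP ij _]; apply: (subset_trans ij); first by rewrite iA.
  by have [] := sP j.
have [i iW] := nbhs_inftyP dirJ (netg _ _ dirJ a ca None W gxW).
(* Tails are strict: the same neighbourhood with a larger counter gives an index beyond [i]. *)
have [j [j1 j2]] := nbhs_indexP i.2.+1 (set_valP i.1).
have [_] := sP j; apply; apply: (iW (Some j)).
by apply/andP; split; [apply/asboolP; rewrite j1|rewrite j2].
Qed.

End Nets.

(** * Path homotopy, and fundamental groups of cones at the apex *)

Section PathHomotopy.
Variable R : realType.
Local Notation I := (unit_interval R).

Lemma path_homotopic_sym (X : topologicalType) (a b : I -> X) :
  path_homotopic a b -> path_homotopic b a.
Proof.
move=> [H [cH H0 H1 Hz Ho]]; exists (fun z => H (z.1, rev_param z.2)); split.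
- apply: comp_continuous cH.
  apply: pair_continuous; first exact: fst_continuous.
  exact: comp_continuous (@snd_continuous _ _) (@rev_param_continuous R).
- by move=> s; rewrite /= rev_param0.
- by move=> s; rewrite /= rev_param1.
- by move=> t; rewrite /= Hz -H1 Hz.
- by move=> t; rewrite /= Ho -H1 Ho.
Qed.

(** The two homotopies run at double speed on the closed halves of the time interval and are pasted
    at time 1/2, where both equal [b]. *)
Lemma path_homotopic_trans (X : topologicalType) (a b c : I -> X) :
  path_homotopic a b -> path_homotopic b c -> path_homotopic a c.
Proof.
move=> [H [cH H0 H1 Hz Ho]] [G [cG G0 G1 Gz Go]].
pose l (t : I) : I := clamp (2 * set_val t).
pose r (t : I) : I := clamp (2 * set_val t - 1).
have c2 : continuous (fun t : I => 2 * set_val t : R).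
  move=> t.
  exact: continuousM (@cst_continuous I R 2 t) (@set_val_continuous R t).
have cl : continuous l by exact: comp_continuous c2 (@clamp_continuous R).
have cr : continuous r.
  apply: comp_continuous (@clamp_continuous R) => t.
  exact: continuousB (c2 t) (@cst_continuous I R 1 t).
have paste (u : I -> I) (F : I * I -> X) : continuous u -> continuous F ->
    continuous (fun z : I * I => F (z.1, u z.2)).
  move=> cu cF; apply: comp_continuous cF.
  apply: pair_continuous; first exact: fst_continuous.
  exact: comp_continuous (@snd_continuous _ _) cu.
pose v (z : I * I) : R := set_val z.2.
have cv : continuous v.
  exact: comp_continuous (@snd_continuous I I) (@set_val_continuous R).
pose A := v @^-1` [set x | x <= 2^-1]; pose B := v @^-1` [set x | 2^-1 <= x].
have clA : closed A by apply: closed_comp (@closed_le R _) => z _; exact: cv.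
have clB : closed B by apply: closed_comp (@closed_ge R _) => z _; exact: cv.
pose K z := if v z <= 2^-1 then H (z.1, l z.2) else G (z.1, r z.2).
exists K; split.
- apply/continuous_subspace_setT.
  have -> : [set: I * I] = A `|` B.
    apply/seteqP; split=> // z _; rewrite /A /B /=.
    by case: (leP (v z) 2^-1) => [|/ltW]; [left|right].
  apply: withinU_continuous => //.
    apply: (@subspace_eq_continuous _ _ _ (fun z => H (z.1, l z.2))).
      by move=> z /set_mem Az; rewrite /from_subspace /K ifT.
    by apply: continuous_subspaceT; exact: paste.
  apply: (@subspace_eq_continuous _ _ _ (fun z => G (z.1, r z.2))).
    move=> z /set_mem Bz; rewrite /from_subspace /K.
    case: (leP (v z) 2^-1) => // Az.
    have vz : v z = 2^-1 by apply/le_anti; rewrite Az.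
    rewrite /l /r -/(v z) vz divff ?pnatr_eq0 // subrr.
    by rewrite (@clamp_ge1 R 1) // (@clamp_le0 R 0) // H1 G0.
  by apply: continuous_subspaceT; exact: paste.
- move=> s; rewrite /K /v /= invr_ge0 ler0n.
  by rewrite /l val_zero mulr0 clamp_le0.
- move=> s; rewrite /K /v /= leNgt invf_lt1 ?ltr0n // ltr1n /=.
  by rewrite /r val_one mulr1 clamp_ge1 // -[1]/(1%:R) -natrB.
- move=> t; rewrite /K; case: ifP => _ /=; first by rewrite Hz.
  by rewrite Gz -H1 Hz.
- move=> t; rewrite /K; case: ifP => _ /=; first by rewrite Ho.
  by rewrite Go -H1 Ho.
Qed.

Lemma path_homotopic_comp (X Y : topologicalType) (f : X -> Y) (a b : I -> X) :
  continuous f -> path_homotopic a b -> path_homotopic (f \o a) (f \o b).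
Proof.
move=> cf [H [cH H0 H1 Hz Ho]]; exists (f \o H); split => /=.
- exact: comp_continuous cH cf.
- by move=> s; rewrite H0.
- by move=> s; rewrite H1.
- by move=> t; rewrite Hz.
- by move=> t; rewrite Ho.
Qed.

Lemma path_homotopic_refl (X : topologicalType) (a : I -> X) :
  continuous a -> path_homotopic a a.
Proof.
move=> ca; exists (a \o fst); split=> //.
exact: comp_continuous (@fst_continuous _ _) ca.
Qed.

(** Every representative of a null-homotopic class has a null-homotopic image, so the union defining
    [pi1_map] collapses to one class. *)
Lemma pi1_map_null (X Y : topologicalType) (f : X -> Y) (a : I -> X) (x : X) :
  continuous f -> path_homotopic a (cst x) ->
  pi1_map f (path_class a) = path_class (cst (f x) : I -> Y).
Proof.
move=> cf ax; apply/seteqP; split=> c /=; last by move=> xc; exists (cst x).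
move=> [b /= ab bc]; apply: path_homotopic_trans bc.
apply: (@path_homotopic_comp _ _ f (cst x) b) => //.
exact: path_homotopic_trans (path_homotopic_sym ax) ab.
Qed.

(** Since [mul_param zero t] is [zero], the contraction fixes the apex at all times; applied along
    [a], it is a homotopy relative to the endpoints. *)
Lemma cone_loop_null (T : topologicalType) (k : T) (a : I -> cone R T) :
  continuous a -> a zero = cone_pi k zero -> a one = cone_pi k zero ->
  path_homotopic a (cst (cone_pi k zero)).
Proof.
move=> ca a0 a1; have [H [cH HE]] := cone_contraction R T.
exists (fun z => H (a z.1, rev_param z.2)); split.
- apply: comp_continuous cH; apply: pair_continuous.
    exact: comp_continuous (@fst_continuous _ _) ca.
  exact: comp_continuous (@snd_continuous _ _) (@rev_param_continuous R).
- move=> s /=; have [l [t ->]] := cone_piP (a s).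
  by rewrite rev_param0 HE mul_param1.
- move=> s /=; have [l [t ->]] := cone_piP (a s).
  by rewrite rev_param1 HE mul_param0; exact: cone_pi0.
- by move=> t; rewrite /= a0 HE mul0_param.
- by move=> t; rewrite /= a1 HE mul0_param.
Qed.

(** Every loop class at the apex is trivial, so its image is the class of the constant path at
    [p xh], which comes from the constant path at [xh]. *)
Lemma cone_pi1 (T Xh X : topologicalType) (p : continuousType Xh X) (xh : Xh)
    (k : T) (f : continuousType (cone R T) X) :
  f (cone_pi k zero) = p xh ->
  pi1_map f @` pi1 R (cone_pi k zero) `<=` pi1_map p @` pi1 R xh.
Proof.
move=> fk _ [_ [a _ <-] <-]; exists (path_class (cst xh)).
  by exists (cst xh).
rewrite (@pi1_map_null _ _ p _ xh); last 2 first.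
- exact: cts_fun.
- exact/path_homotopic_refl/cst_continuous.
rewrite (@pi1_map_null _ _ f a (cone_pi k zero)) ?fk //.
- exact: cts_fun.
- by apply: cone_loop_null; [exact: cts_fun|exact: path_zero|exact: path_one].
Qed.

End PathHomotopy.

(** * From lifting over fans to continuous lifting of paths *)

Section FanCovering.
Variables (R : realType) (Xh X : topologicalType) (p : continuousType Xh X).
Hypothesis fancov : weak_covering_map R (fan_category R) p.
Local Notation I := (unit_interval R).

Section Fan.
Variables (d : Order.disp_t) (J : preorderType d).
Hypothesis dirJ : directed_set J.
Local Notation K := (with_infty J).

(** The covering property for the fan, based at the apex, restated before passing to the quotient so
    that later arguments can curry and uncurry. *)
Lemma fan_lift (h : K * I -> X) (xh : Xh) : continuous h ->
  (forall k, h (k, zero) = p xh) ->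
  exists hh : K * I -> Xh, [/\ continuous hh,
    forall k, hh (k, zero) = xh, forall z, p (hh z) = h z &
    forall hh' : K * I -> Xh, continuous hh' ->
      (forall k, hh' (k, zero) = xh) -> (forall z, p (hh' z) = h z) ->
      hh' = hh].
Proof.
move=> ch h0; pose f := cone_lift (fun k s => h (k, s)).
have f0 k l : h (k, zero) = h (l, zero) by rewrite !h0.
have cf : continuous (f : arc_fan R J -> X).
  apply: cone_lift_continuous => //.
  have hE : (fun ks : K * I => h (ks.1, ks.2)) = h by apply/funext => -[].
  by rewrite hE.
have fE k s : f (cone_pi k s) = h (k, s) by exact: cone_lift_pi.
pose F : continuousType (arc_fan R J) X :=
  HB.pack f (isContinuous.Build _ _ f cf).
have Fb : F (cone_pi (None : K) zero) = p xh by rewrite -(h0 None) -fE.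
have [fh [[cfh fh0 pfh] ufh]] :=
  fancov (Fan_arc_fan R dirJ) Fb (cone_pi1 Fb).
exists (fun z => fh (cone_pi z.1 z.2)); split.
- exact: comp_continuous (@cone_pi_continuous R K) cfh.
- by move=> k; rewrite /= -fh0 (cone_pi0 R k (None : K)).
- by case=> k s; rewrite -[LHS]/((p \o fh) (cone_pi k s)) pfh /= fE.
(* A competing lift is constant at [zero], so it descends to the fan, where uniqueness identifies it
   with [fh]. *)
- move=> hh ch' hh0 phh.
  have hhE k s : cone_lift (fun k s => hh (k, s)) (cone_pi k s) = hh (k, s).
    by apply: cone_lift_pi => *; rewrite !hh0.
  apply/funext => -[k s]; rewrite -hhE; congr (_ _).
  symmetry; apply: ufh; split.
  + apply: cone_lift_continuous; first by move=> *; rewrite !hh0.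
    have hE : (fun ks : K * I => hh (ks.1, ks.2)) = hh by apply/funext => -[].
    by rewrite hE.
  + by rewrite hhE hh0.
  + apply/funext => c; have [l [t ->]] := cone_piP c.
    by rewrite /= hhE phh fE.
Qed.

End Fan.

(** Index set for the constant families through which a single path is lifted. *)
Lemma nat_directed : directed_set nat.
Proof.
split; first by exists 0.
by move=> i j; exists (maxn i j); rewrite !leEnat leq_maxl leq_maxr.
Qed.

Lemma fan_covering_clp : continuous_lifting_of_paths R p.
Proof.
move=> xh.
(* Surjectivity: the family constantly equal to [a] lifts over the fan, and the arc at [None] is the
   required path. *)
have lift (a : path_space R (p xh)) :
    exists b : path_space R xh, path_space_map p b = a.
  have [||h [ch h0 ph _]] := @fan_lift _ _ nat_directed
    (fun z => (\val a : I -> X) z.2) xh.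
  - have ca := @path_space_continuous _ _ _ a.
    exact: comp_continuous (@snd_continuous _ _) ca.
  - by move=> k; exact: path_space_zero.
  have cb : continuous (fun t => h (None, t)).
    apply: comp_continuous ch.
    by apply: pair_continuous; [exact: cst_continuous|exact: id_continuous].
  exists (mk_path_space cb (h0 None)).
  by apply/val_inj/funext => t; rewrite /= ph.
(* Injectivity: two lifts of one path give constant families lifting the same map on the fan, hence
   equal. *)
have inj : injective (@path_space_map R _ _ p xh).
  move=> a b /(congr1 val) /= pab.
  have ch (c : path_space R xh) : continuous
      (fun z : with_infty nat * I => (\val c : I -> Xh) z.2).
    have cc := @path_space_continuous _ _ _ c.
    exact: comp_continuous (@snd_continuous _ _) cc.
  have [||h [_ _ _ hu]] := @fan_lift _ _ nat_directed
    (fun z => p ((\val a : I -> Xh) z.2)) xh.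
  - exact: comp_continuous (ch a) (@cts_fun _ _ p).
  - by move=> k; rewrite /= path_space_zero.
  have ha : (fun z : with_infty nat * I => (\val a : I -> Xh) z.2) = h.
    by apply: hu => // k; rewrite /= path_space_zero.
  have hb : (fun z : with_infty nat * I => (\val b : I -> Xh) z.2) = h.
    apply: hu => // [k|z]; first by rewrite /= path_space_zero.
    exact: (esym (congr1 (@^~ z.2) pab)).
  apply/val_inj/funext => t.
  by have := congr1 (@^~ (None, t)) (etrans ha (esym hb)).
have [g gK] := choice lift.
exists g; split => //.
- by move=> b; apply: inj; rewrite gK.
- exact: path_space_map_continuous.
(* Continuity of the inverse: the net of paths, uncurried, lifts over its fan. Currying the lift
   gives a continuous [b], and injectivity forces [g \o a = b]. *)
apply: net_continuous => d J dirJ a ca.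
have [||h [ch h0 ph _]] := @fan_lift _ _ dirJ
  (fun z => (\val (a z.1) : I -> X) z.2) xh.
- exact: path_space_uncurry.
- by move=> k; exact: path_space_zero.
have [b cb bE] := path_space_curry ch h0.
suff -> : g \o a = b by [].
apply/funext => k; apply: inj; rewrite /= gK; apply/val_inj/funext => t /=.
by rewrite bE ph.
Qed.

End FanCovering.

Theorem proposition67 (R : realType) (Xh X : topologicalType)
    (p : continuousType Xh X)
    (hXh : path_connected R Xh) (hX : path_connected R X) :
  [<-> continuous_lifting_of_paths R p;
       weak_covering_map R (fan_category R) p;
       weak_covering_map R (contractible R) p].
Proof.
have cntr_fan : weak_covering_map R (contractible R) p ->
    weak_covering_map R (fan_category R) p.
  by move=> cov Y /fan_category_contractible; exact: cov.
have fan_clp := @fan_covering_clp R Xh X p.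
have clp_cntr := @clp_weak_covering R Xh X p.
tfae.
- by move=> /clp_cntr/cntr_fan.
- by move=> /fan_clp/clp_cntr.
- by move=> /cntr_fan/fan_clp.
Qed.
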